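(* Let $R$ be a multiplicative hyperring. If $I$ is a $J$-prime hyperideal of $R$, then $I$ is a 2-absorbing $J$-prime hyperideal of $R$.
   Context: A multiplicative hyperring is a nonempty set $R$ with an operation $+$ and a hyperoperation $\circ: R\times R\to P^*(R)$ (where $P^*(R)$ is the set of nonempty subsets of $R$) such that: $(R,+)$ is an abelian group; $\circ$ is associative; $a\circ(b+c)\subseteq a\circ b+a\circ c$ and $(b+c)\circ a\subseteq b\circ a+c\circ a$; and $a\circ(-b)=(-a)\circ b=-(a\circ b)$ for all $a,b,c\in R$. For nonempty subsets $A,B\subseteq R$, $A\circ B=\bigcup_{x\in A,\,y\in B}x\circ y$, and $A\circ r=A\circ\{r\}$. Standing assumptions: $R$ is commutative with an identity $1$, meaning $a\in a\circ 1$ for all $a\in R$. A hyperideal of $R$ is a nonempty subset $I\subseteq R$ with $a-b\in I$ for $a,b\in I$ and $r\circ x\subseteq I$ for $x\in I$, $r\in R$. Let $\mathbf{C}=\{r_1\circ r_2\circ\cdots\circ r_n : r_i\in R,\ n\in\mathbb{N}\}$; a hyperideal $I$ is a $\mathbf{C}$-hyperideal if for every $A\in\mathbf{C}$, $A\cap I\neq\varnothing$ implies $A\subseteq I$. Standing assumption: all hyperideals are $\mathbf{C}$-hyperideals. A proper hyperideal $M$ is maximal if every hyperideal $N$ with $M\subsetneq N\subseteq R$ equals $R$; the Jacobson radical $J(R)$ is the intersection of all maximal hyperideals of $R$. A proper hyperideal $I$ is $J$-prime if for all $x,y\in R$, $x\circ y\subseteq I$ implies $x\in J(R)$ or $y\in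 I$. A proper hyperideal $I$ is 2-absorbing $J$-prime if for all $x,y,z\in R$, $x\circ y\circ z\subseteq I$ implies $x\circ y\subseteq I$ or $x\circ z\subseteq J(R)$ or $y\circ z\subseteq J(R)$. *)

(* Defs.v *)
From HB Require Import structures.
From mathcomp Require Import all_boot all_algebra.
From mathcomp Require Import boolp classical_sets.

Set Implicit Arguments.
Unset Strict Implicit.
Unset Printing Implicit Defensive.

Import GRing.Theory.
Local Open Scope ring_scope.
Local Open Scope classical_set_scope.

Definition hmul_set_of (T : Type) (op : T -> T -> set T) (A B : set T) : set T :=
  \bigcup_(x in A) \bigcup_(y in B) op x y.

HB.mixin Record Zmodule_isMultHyperring R of GRing.Zmodule R := {
  hmul : R -> R -> set R;
  hmul_nonempty : forall a b : R, hmul a b !=set0;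
  hmulA : forall a b c : R,
    hmul_set_of hmul [set a] (hmul b c) = hmul_set_of hmul (hmul a b) [set c];
  hmulDr_sub : forall a b c : R,
    hmul a (b + c) `<=` [set u + v | u in hmul a b & v in hmul a c];
  hmulDl_sub : forall a b c : R,
    hmul (b + c) a `<=` [set u + v | u in hmul b a & v in hmul c a];
  hmulrN : forall a b : R, hmul a (- b) = [set - u | u in hmul a b];
  hmulNr : forall a b : R, hmul (- a) b = [set - u | u in hmul a b]
}.

#[short(type="multHyperringType")]
HB.structure Definition MultHyperring :=
  { R of GRing.Zmodule R & Zmodule_isMultHyperring R }.

(* An identity need not satisfy hmul a hone = [set a], nor be unique. *)
HB.mixin Record MultHyperring_isComUnital R of MultHyperring R := {
  hone : R;
  hmulC : forall a b : R, hmul a b = hmul b a;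
  hmul1_mem : forall a : R, hmul a hone a
}.

#[short(type="comMultHyperringType")]
HB.structure Definition ComMultHyperring :=
  { R of MultHyperring R & MultHyperring_isComUnital R }.

Section Hyperideals.
Variable R : comMultHyperringType.
Implicit Types (A B I J M N : set R) (r x y z : R).

Definition hmul_set A B : set R := hmul_set_of (@hmul R) A B.

Definition hyperideal I : Prop :=
  [/\ I !=set0,
      forall a b, I a -> I b -> I (a - b)
    & forall r x, I x -> hmul r x `<=` I].

(* The head is kept apart so that only products of n >= 1 factors occur: with
   weak identities there is no canonical empty product. *)
Definition hprod r (s : seq R) : set R :=
  foldl (fun A x => hmul_set A [set x]) [set r] s.

Definition C_class : set (set R) := [set A | exists r s, A = hprod r s].

Definition C_hyperideal I : Prop :=
  hyperideal I /\ forall A, C_class A -> A `&` I !=set0 -> A `<=` I.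

Definition proper_hyperideal I : Prop := hyperideal I /\ I <> setT.

Definition maximal_hyperideal M : Prop :=
  proper_hyperideal M /\ forall N, hyperideal N -> M `<` N -> N = setT.

(* Equal to setT when there is no maximal hyperideal. *)
Definition jacobson_radical : set R :=
  \bigcap_(M in [set M | maximal_hyperideal M]) M.

Definition J_prime I : Prop :=
  proper_hyperideal I /\
  forall x y, hmul x y `<=` I -> jacobson_radical x \/ I y.

Definition two_absorbing_J_prime I : Prop :=
  proper_hyperideal I /\
  forall x y z, hmul_set (hmul x y) [set z] `<=` I ->
    [\/ hmul x y `<=` I,
        hmul x z `<=` jacobson_radical
      | hmul y z `<=` jacobson_radical].

End Hyperideals.

Arguments jacobson_radical R : clear implicits.

(* Main.v *)
Require Import Defs.
From mathcomp Require Import all_boot all_algebra.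
From mathcomp Require Import boolp classical_sets.

(** The dichotomy is whether [z] lies in the Jacobson radical. If it does, so
    does every product with factor [z], because the radical absorbs
    multiplication ([jacobson_radical_absorbs]). If it does not, every [u] in
    the hyperproduct of [x] and [y] satisfies [hmul z u `<=` I] by
    commutativity, and J-primeness puts [u] in [I]. *)

Local Open Scope classical_set_scope.

Lemma jacobson_radical_absorbs (R : comMultHyperringType) (r x : R) :
  jacobson_radical R x -> hmul r x `<=` jacobson_radical R.
Proof.
move=> Jx w rxw M maxM.
have [[[_ _ absM] _] _] := maxM.
exact: absM (Jx M maxM) _ rxw.
Qed.

Theorem theorem5p4 (R : comMultHyperringType)
    (all_C : forall K : set R, hyperideal K -> C_hyperideal K)
    (I : set R) :
  J_prime I -> two_absorbing_J_prime I.
Proof.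
move=> [propI primeI]; split=> // x y z xyzI.
have [Jz|nJz] := pselect (jacobson_radical R z).
  by apply: Or32; apply: jacobson_radical_absorbs.
apply: Or31 => u xyu.
have zuI : hmul z u `<=` I.
  by rewrite hmulC => w uzw; apply: xyzI; exists u => //; exists z.
by case: (primeI z u zuI).
Qed.
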